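(* Let $n \geq 3$ be an odd integer. Then for every integer $m \geq 2$, \[\mu_s(C_n + \overline{K_m}) \leq mn - (n+m) + 1.\]
   Context: All graphs are finite and simple. For a graph $G$ with $p=|V(G)|$ vertices and $q=|E(G)|$ edges, a super edge-magic labeling is a bijection $f: V(G)\cup E(G)\to\{1,2,\ldots,p+q\}$ with $f(V(G))=\{1,\ldots,p\}$ such that $f(x)+f(xy)+f(y)$ is the same constant for every edge $xy$; $G$ is super edge-magic if it has such a labeling. The super edge-magic deficiency $\mu_s(G)$ is the minimum nonnegative integer $t$ such that $G\cup tK_1$ (disjoint union of $G$ with $t$ isolated vertices) is super edge-magic, or $+\infty$ if no such $t$ exists. The join $G_1+G_2$ of two vertex-disjoint graphs is their union together with all edges joining a vertex of $G_1$ to a vertex of $G_2$. $C_n$ is the cycle on $n$ vertices and $\overline{K_m}$ is the graph with $m$ vertices and no edges. *)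

(* Defs.v *)
From mathcomp Require Import all_boot.
From mathcomp Require Import boolp.

Set Implicit Arguments.
Unset Strict Implicit.
Unset Printing Implicit Defensive.

Record sgraph := SGraph {
  vertex :> finType;
  adj : rel vertex;
  adj_sym : symmetric adj;
  adj_irrefl : irreflexive adj }.

Definition edges (G : sgraph) : {set {set G}} :=
  [set e : {set G} | [exists x, exists y, adj x y && (e == [set x; y])]].

Definition edge (G : sgraph) : finType := {e : {set G} | e \in edges G}.

Section Constructions.

Definition empty_adj (T : finType) : rel T := fun _ _ => false.

Fact empty_adj_sym T : symmetric (@empty_adj T).
Proof. by []. Qed.

Fact empty_adj_irrefl T : irreflexive (@empty_adj T).
Proof. by []. Qed.

(* The edgeless graph on m vertices: both the complement of K_m and m K_1. *)
Definition edgeless (m : nat) : sgraph :=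
  SGraph (@empty_adj_sym 'I_m) (@empty_adj_irrefl 'I_m).

(* The conjunct i != j only matters for n = 1, where it removes a loop; this is
   the usual cycle C_n when n >= 3. *)
Definition cycle_adj (n : nat) : rel 'I_n := fun i j =>
  (i != j) && ((i.+1 %% n == j) || (j.+1 %% n == i)).

Fact cycle_adj_sym n : symmetric (@cycle_adj n).
Proof. by move=> i j; rewrite /cycle_adj eq_sym orbC. Qed.

Fact cycle_adj_irrefl n : irreflexive (@cycle_adj n).
Proof. by move=> i; rewrite /cycle_adj eqxx. Qed.

Definition cycle_graph (n : nat) : sgraph :=
  SGraph (@cycle_adj_sym n) (@cycle_adj_irrefl n).

Variables G H : sgraph.

Definition union_adj : rel (G + H)%type := fun u v =>
  match u, v with
  | inl x, inl y => adj x y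
  | inr x, inr y => adj x y
  | _, _ => false
  end.

Fact union_adj_sym : symmetric union_adj.
Proof. by case=> x [] y //=; rewrite adj_sym. Qed.

Fact union_adj_irrefl : irreflexive union_adj.
Proof. by case=> x /=; rewrite adj_irrefl. Qed.

Definition disjoint_union : sgraph := SGraph union_adj_sym union_adj_irrefl.

Definition join_adj : rel (G + H)%type := fun u v =>
  match u, v with
  | inl x, inl y => adj x y
  | inr x, inr y => adj x y
  | _, _ => true
  end.

Fact join_adj_sym : symmetric join_adj.
Proof. by case=> x [] y //=; rewrite adj_sym. Qed.

Fact join_adj_irrefl : irreflexive join_adj.
Proof. by case=> x /=; rewrite adj_irrefl. Qed.

Definition join : sgraph := SGraph join_adj_sym join_adj_irrefl.

End Constructions.

(* The domain V(G) \cup E(G) is the sum type G + edge G; labels are natural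
   numbers, and the second condition says that the image is {1, ..., p + q}. *)
Definition super_edge_magic_labeling (G : sgraph) (f : G + edge G -> nat) : Prop :=
  [/\ injective f,
      forall k : nat,
        (exists z, f z = k) <-> (1 <= k <= #|G| + #|edges G|),
      forall k : nat, (exists x : G, f (inl x) = k) <-> (1 <= k <= #|G|)
    & exists c : nat, forall (e : edge G) (x y : G),
        val e = [set x; y] -> f (inl x) + f (inr e) + f (inl y) = c].

Definition super_edge_magic (G : sgraph) : Prop :=
  exists f : G + edge G -> nat, super_edge_magic_labeling f.

(* None stands for +oo. *)
Definition super_edge_magic_deficiency (G : sgraph) : option nat :=
  match pselect (exists t, `[< super_edge_magic (disjoint_union G (edgeless t)) >]) with
  | left h => Some (ex_minn h)
  | right _ => None
  end.

Definition enat_le (a b : option nat) : bool :=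
  match a, b with
  | _, None => true
  | None, Some _ => false
  | Some s, Some t => s <= t
  end.

(* Main.v *)
Require Import Defs.
From mathcomp Require Import all_boot.
From mathcomp Require Import boolp zify.

Set Implicit Arguments.
Unset Strict Implicit.
Unset Printing Implicit Defensive.

(** Write n = 2h+1.  Label the cycle by the consecutive block h+2, ..., 3h+2,
    alternating between its lower and its upper half, so that the cycle edges
    have the n consecutive sums 3h+4, ..., 5h+4.  Joining the whole cycle to a
    vertex labeled b gives the n consecutive sums b+h+2, ..., b+3h+2.  Hence the
    labels 1, 1+2n, 1+3n, ..., 1+mn for the vertices of the edgeless graph make
    all m+1 blocks of sums adjacent: the label 1 gives the block just below the
    cycle sums, the others those above.  The labels left free in
    {1, ..., mn+1} go to (m-1)(n-1) isolated vertices, and the edge labels are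
    the complements of the sums to the magic constant. *)

(** * Super edge-magic labelings from consecutive edge sums *)

Lemma inj_bounded_onto (T : finType) (f : T -> nat) :
  injective f -> (forall x, 1 <= f x <= #|T|) ->
  forall k, (exists x, f x = k) <-> 1 <= k <= #|T|.
Proof.
move=> finj fb k; split=> [[x <-] //|kb].
have fuq : uniq (codom f) by rewrite map_inj_uniq ?enum_uniq.
have fsub : {subset codom f <= iota 1 #|T|}.
  by move=> _ /codomP[x ->]; rewrite mem_iota add1n ltnS.
have [|_ codomE] := uniq_min_size fuq fsub.
  by rewrite size_iota size_codom.
have: k \in codom f by rewrite codomE mem_iota add1n ltnS.
by case/codomP=> x ->; exists x.
Qed.

Lemma sum_pair (T : finType) (f : T -> nat) (x y : T) :
  x != y -> \sum_(z in [set x; y]) f z = f x + f y.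
Proof. by move=> xy; rewrite big_setU1 ?inE // big_set1. Qed.

Lemma edge_pair_neq (G : sgraph) (x y : G) : [set x; y] \in edges G -> x != y.
Proof.
rewrite inE => /existsP[u /existsP[v /andP[uv /eqP xyE]]].
have uv' : u != v by apply: contraTneq uv => ->; rewrite adj_irrefl.
by have := cards2 x y; rewrite xyE cards2 uv'; case: (x != y).
Qed.

(** The sums are pairwise distinct, so [I] enumerates the edges without repetition. They fill an
    interval of length [#|I|], and subtracting them from a constant gives edge labels that fill the
    interval just above [#|G|]. *)
Lemma super_edge_magic_consecutive_sums (G : sgraph) (f : G -> nat)
    (I : finType) (u v : I -> G) (rk : I -> nat) (s : nat) :
  injective f -> (forall x, 1 <= f x <= #|G|) ->
  (forall i, adj (u i) (v i)) ->
  (forall x y, adj x y -> exists i, [set x; y] = [set u i; v i]) ->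
  injective rk -> (forall i, rk i < #|I|) ->
  (forall i, f (u i) + f (v i) = s + rk i) ->
  super_edge_magic G.
Proof.
move=> finj fb uvadj adjuv rkinj rkb fsum.
pose E i := [set u i; v i].
(* Summing over the set makes the sum a function of the unordered edge, with no choice of
   endpoints. *)
pose sigma (e : {set G}) := \sum_(x in e) f x.
have uvN i : u i != v i.
  by apply: contraTneq (uvadj i) => ->; rewrite adj_irrefl.
have sigmaE i : sigma (E i) = s + rk i by rewrite /sigma sum_pair.
have Einj : injective E.
  move=> i j /(congr1 sigma); rewrite !sigmaE => /eqP.
  by rewrite eqn_add2l => /eqP /rkinj.
have edgeE : edges G = E @: I.
  apply/setP=> e; rewrite inE; apply/existsP/imsetP.
    case=> x /existsP[y /andP[xy /eqP ->]].
    by have [i ->] := adjuv _ _ xy; exists i.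
  case=> i _ ->; exists (u i); apply/existsP; exists (v i).
  by rewrite uvadj /E eqxx.
have cardE : #|edges G| = #|I| by rewrite edgeE card_imset.
have edgeP (e : edge G) : exists i, val e = E i.
  by case: e => e /= ee; move: (ee); rewrite edgeE => /imsetP[i _ ->]; exists i.
pose F (z : G + edge G) := match z with
  | inl x => f x
  | inr e => #|G| + #|I| + s - sigma (val e)
  end.
(* Since [rk i < #|I|], the truncated subtraction is exact and edge labels exceed all vertex
   labels. *)
have Finr e : exists2 i, val e = E i & F (inr e) = #|G| + (#|I| - rk i).
  have [i ei] := edgeP e; exists i => //; rewrite /F ei sigmaE.
  by have := rkb i; lia.
have Finj : injective F.
  move=> [x|e] [y|e'].
  - by move/finj->.
  - have [i _ ->] := Finr e'; rewrite /F => fx.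
    by have := fb x; have := rkb i; lia.
  - have [i _ ->] := Finr e; rewrite /F => fx.
    by have := fb y; have := rkb i; lia.
  - have [i ei ->] := Finr e; have [j ej ->] := Finr e' => eq_ij.
    have ij : i = j by apply: rkinj; have := rkb i; have := rkb j; lia.
    by congr inr; apply: val_inj; rewrite ei ej ij.
have cardF : #|{: G + edge G}| = #|G| + #|edges G|.
  by rewrite card_sum card_sig.
exists F; split=> //.
- rewrite -cardF; apply: inj_bounded_onto => // -[x|e].
    by rewrite cardF /F; have := fb x; lia.
  have [i _ ->] := Finr e; rewrite cardF cardE.
  by have := rkb i; lia.
- by apply: inj_bounded_onto.
- exists (#|G| + #|I| + s) => e x y exy.
  have [i ei] := edgeP e.
  have xyN : x != y by apply: (@edge_pair_neq G); rewrite -exy; apply: valP.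
  have := sigmaE i; rewrite -ei /F exy /sigma sum_pair //.
  by have := rkb i; lia.
Qed.

(** By counting, exactly [t] labels lie outside the image of [f]; [g] lists them. *)
Lemma inj_label_padding (T : finType) (f : T -> nat) (t : nat) :
  injective f -> (forall x, 1 <= f x <= #|T| + t) ->
  exists g : 'I_t -> nat,
    [/\ injective g, forall j, 1 <= g j <= #|T| + t & forall x j, f x != g j].
Proof.
move=> finj fb; pose p := #|T| + t.
pose free := [seq k <- iota 1 p | k \notin codom f].
have fuq : uniq (codom f) by rewrite map_inj_uniq ?enum_uniq.
have cnt : count [in codom f] (iota 1 p) = #|T|.
  rewrite -size_filter -(size_codom f); apply/perm_size/uniq_perm => //.
    by rewrite filter_uniq ?iota_uniq.
  move=> k; rewrite mem_filter mem_iota; apply/andb_idr => /codomP[x ->].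
  by rewrite add1n ltnS fb.
have sz : size free = t.
  rewrite size_filter; have := count_predC [in codom f] (iota 1 p).
  by rewrite cnt size_iota => /addnI.
have freeP (j : 'I_t) : nth 0 free j \in free by rewrite mem_nth ?sz.
exists (fun j : 'I_t => nth 0 free j); split.
- move=> i j /eqP; rewrite nth_uniq ?sz ?filter_uniq ?iota_uniq //.
  by move/eqP/val_inj.
- move=> j; have := freeP j; rewrite mem_filter mem_iota add1n ltnS.
  by case/andP.
- move=> x j; apply: contraTneq (freeP j) => <-.
  by rewrite mem_filter codom_f.
Qed.

Lemma super_edge_magic_padding (G : sgraph) (t : nat) (f : G -> nat)
    (I : finType) (u v : I -> G) (rk : I -> nat) (s : nat) :
  injective f -> (forall x, 1 <= f x <= #|G| + t) ->
  (forall i, adj (u i) (v i)) ->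
  (forall x y, adj x y -> exists i, [set x; y] = [set u i; v i]) ->
  injective rk -> (forall i, rk i < #|I|) ->
  (forall i, f (u i) + f (v i) = s + rk i) ->
  super_edge_magic (disjoint_union G (edgeless t)).
Proof.
move=> finj fb uvadj adjuv rkinj rkb fsum.
have [g [ginj gb fg]] := inj_label_padding finj fb.
pose F (z : disjoint_union G (edgeless t)) :=
  match z with inl x => f x | inr j => g j end.
have cardU : #|disjoint_union G (edgeless t)| = #|G| + t.
  by rewrite card_sum card_ord.
apply: (@super_edge_magic_consecutive_sums _ F I (inl \o u) (inl \o v) rk s) => //.
- move=> [x|j] [y|j'] /=.
  + by move/finj->.
  + by move/eqP; rewrite (negPf (fg _ _)).
  + by move/esym/eqP; rewrite (negPf (fg _ _)).
  + by move/ginj->.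
- by rewrite cardU; case.
- case=> [x|j] [y|j'] //= xy.
  have [i uvi] := adjuv _ _ xy; exists i.
  (* The equality of pairs is carried into the union by taking images under [inl]. *)
  by have := congr1 (fun A : {set G} => [set inl z | z in A] : {set G + 'I_t}) uvi;
    rewrite !imsetU1 !imset_set1.
Qed.

Lemma deficiency_le (G : sgraph) (t : nat) :
  super_edge_magic (disjoint_union G (edgeless t)) ->
  enat_le (super_edge_magic_deficiency G) (Some t).
Proof.
move=> Gt; rewrite /super_edge_magic_deficiency; case: pselect => [ex|[]] /=.
  by case: ex_minnP => s _; apply; apply/asboolP.
by exists t; apply/asboolP.
Qed.

(** * The labeling of the cycle and of its join *)

(** Even positions run through 0, ..., h and odd ones through h+1, ..., 2h. *)
Definition zigzag (h i : nat) : nat := i./2 + odd i * h.+1.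

Lemma zigzag_lt (h i : nat) : i < h.*2.+1 -> zigzag h i < h.*2.+1.
Proof. by rewrite /zigzag; case: (odd i) (odd_double_half i) => /=; lia. Qed.

Lemma zigzag_inj (h i j : nat) : i < h.*2.+1 -> j < h.*2.+1 ->
  zigzag h i = zigzag h j -> i = j.
Proof.
rewrite /zigzag.
by case: (odd i) (odd_double_half i); case: (odd j) (odd_double_half j) => /=; lia.
Qed.

(** Each step along the cycle raises the sum by one; the closing edge, from 2h back to 0, supplies
    the smallest sum h. *)
Lemma zigzag_sum (h i : nat) : i < h.*2.+1 ->
  zigzag h i + zigzag h (i.+1 %% h.*2.+1) = h + i.+1 %% h.*2.+1.
Proof.
rewrite /zigzag ltnS leq_eqVlt => /predU1P[->|lt_i].
  by rewrite modnn odd_double doubleK /= !addn0.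
rewrite modn_small //= uphalf_half.
by case: (odd i) (odd_double_half i) => /=; lia.
Qed.

(* Position of the block of sums contributed by the [j]-th vertex of the
   edgeless graph; position 1 is taken by the cycle edges. *)
Definition block (j : nat) : nat := j + (0 < j).

Lemma block_inj : injective block.
Proof. by move=> [|i] [|j]; rewrite /block /=; lia. Qed.

Lemma eq_mulnD_small (n a b r s : nat) : r < n -> s < n ->
  a * n + r = b * n + s -> a = b /\ r = s.
Proof.
move=> rn sn eq_abrs; have n0 : 0 < n by case: n rn {sn eq_abrs}.
split.
  by have := congr1 (divn^~ n) eq_abrs; rewrite /= !divnMDl ?divn_small ?addn0.
by have := congr1 (modn^~ n) eq_abrs; rewrite /= !modnMDl !modn_small.
Qed.

Lemma join_cycle_edgeless_sem (h m : nat) : 0 < h -> 1 < m ->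
  let n := h.*2.+1 in
  super_edge_magic (disjoint_union (join (cycle_graph n) (edgeless m))
                                   (edgeless (m * n - (n + m) + 1))).
Proof.
move=> h0 m1 n; set G := join _ _.
pose f (x : G) := match x with
  | inl i => h + 2 + zigzag h (val i)
  | inr j => 1 + block (val j) * n
  end.
pose I : finType := ('I_n + 'I_n * 'I_m)%type.
pose u (e : I) : G := match e with inl i => inl i | inr p => inl p.1 end.
pose v (e : I) : G := match e with inl i => inl (ordS i) | inr p => inr p.2 end.
(* The rank is the sum minus h+3, the least sum, in the form block times n plus offset; hence the
   explicit factor 1. *)
pose rk (e : I) := match e with
  | inl i => 1 * n + val (ordS i)
  | inr p => block (val p.2) * n + zigzag h (val p.1)
  end.
have zz_lt (i : 'I_n) : zigzag h i < n by apply: zigzag_lt.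
have block_le (j : 'I_m) : block j <= m.
  by have := ltn_ord j; rewrite /block; lia.
have block_neq1 j : block j <> 1 by case: j => [|j]; rewrite /block; lia.
(* The cycle labels lie strictly between 1 and 1+2n, the two smallest labels of the other side. *)
have cycle_sep (i : 'I_n) j : h + 2 + zigzag h i <> 1 + block j * n.
  have := zz_lt i; case: j => [|j]; first by rewrite /block /=; lia.
  by rewrite /block /= addn1 !mulSn; lia.
have cardG : #|G| + (m * n - (n + m) + 1) = m * n + 1.
  rewrite card_sum !card_ord; suff : n + m <= m * n by lia.
  by rewrite /n; nia.
apply: (@super_edge_magic_padding G _ f I u v rk (h + 3)).
- move=> [i|j] [i'|j'] /= => [/addnI/zigzag_inj ii'|/cycle_sep //| /esym/cycle_sep //|/eqP].
    by congr inl; apply: val_inj; apply: ii'.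
  rewrite eqn_add2l eqn_pmul2r // => /eqP/block_inj/val_inj jj'.
  by rewrite jj'.
- rewrite cardG => -[i|j] /=.
    have := zz_lt i; suff : n + n <= m * n by lia.
    by rewrite addnn -mul2n leq_mul2r m1 orbT.
  by have := leq_mul (block_le j) (leqnn n); lia.
- case=> [i|[i j]] //=; rewrite /cycle_adj eqxx andbT.
  apply/eqP => /(congr1 val) /=; have := ltn_ord i; rewrite ltnS leq_eqVlt.
  (* The last vertex wraps around to 0, which differs from 2h because h is positive. *)
  case/predU1P=> [->|lt_i]; first by rewrite modnn; lia.
  by rewrite modn_small //; lia.
- move=> [i|j] [i'|j'] //= => [|_|_].
  + case/andP=> _ /orP[] /eqP ii'.
      by exists (inl i); rewrite /u /v; congr [set _; inl _]; apply: val_inj.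
    exists (inl i'); rewrite /u /v setUC; congr [set _; inl _].
    exact: val_inj.
  + by exists (inr (i, j')).
  + by exists (inr (i', j)); rewrite setUC.
- have ordS_lt (i : 'I_n) : i.+1 %% n < n by rewrite ltn_pmod.
  (* Offsets are below n, so the rank determines both block and offset; mixed cases fail because no
     [block j] equals 1. *)
  move=> [i|[i j]] [i'|[i' j']] /= rkE.
  + have [_ ii'] := eq_mulnD_small (ordS_lt i) (ordS_lt i') rkE.
    by congr inl; apply: ordS_inj; apply: val_inj.
  + by have [/esym/block_neq1] := eq_mulnD_small (ordS_lt i) (zz_lt i') rkE.
  + by have [/block_neq1] := eq_mulnD_small (zz_lt i) (ordS_lt i') rkE.
  + have [/block_inj jj' ii'] := eq_mulnD_small (zz_lt i) (zz_lt i') rkE.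
    congr (inr (_, _)); apply: val_inj => //.
    exact: zigzag_inj (ltn_ord i) (ltn_ord i') ii'.
- rewrite card_sum card_prod !card_ord => -[i|[i j]] /=.
    have : i.+1 %% n < n by rewrite ltn_pmod.
    suff : n <= n * m by lia.
    by rewrite leq_pmulr //; lia.
  have := leq_mul (block_le j) (leqnn n); have := zz_lt i; lia.
- case=> [i|[i j]] /=; last lia.
  have := zigzag_sum (ltn_ord i); rewrite -/n; lia.
Qed.

Theorem theorem5 (n : nat) (hn : 3 <= n) (hodd : odd n) (m : nat) (hm : 2 <= m) :
  enat_le (super_edge_magic_deficiency (join (cycle_graph n) (edgeless m)))
          (Some (m * n - (n + m) + 1)).
Proof.
have nE : n = n./2.*2.+1 by rewrite -[LHS]odd_double_half hodd.
apply: deficiency_le; rewrite nE.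
by apply: join_cycle_edgeless_sem => //; lia.
Qed.
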